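(* For every $n\ge 1$, the map $\Phi$ (defined in the context) is well defined, i.e. for every snake $\pi$ of type $B_n$ the pair $\Phi(\pi)=(P;W)$ is a labeled ballot path of length $n$, and $\Phi$ is a bijection from the set of snakes of type $B_n$ onto the set of labeled ballot paths of length $n$.
   Context: A signed permutation of $[n]=\{1,\dots,n\}$ is a word $\pi=\pi_1\cdots\pi_n$ obtained from a permutation of $[n]$ by giving some entries a minus sign; $-i$ is written $\bar i$. Signed entries are compared in the order $\bar n<\cdots<\bar 1<1<\cdots<n$. A snake of type $B_n$ is a signed permutation with $0<\pi_1>\pi_2<\pi_3>\pi_4<\cdots\pi_n$ (alternating relations throughout). A ballot path of length $n$ is a lattice path from $(0,0)$ with $n$ steps, each an up step $u=(1,1)$ or a down step $d=(1,-1)$, never going below the $x$-axis. The height of a step is the smaller of the $y$-coordinates of its two endpoints. A labeled ballot path $(P;W)$, $P=p_1\cdots p_n$, $W=w_1\cdots w_n$, is a ballot path in which each step $p_i$ carries an integer label $w_i$ with $0\le w_i\le$ height of $p_i$. Inversion code: for a snake $\pi$ of type $B_n$ and $1\le i\le n$, if $n$ is odd let $c_i(\pi)$ be the number of $k$ with $1\le k\le (n-1)/2$, $i<2k$ and $\pi_{2k}<\pi_i<\pi_{2k+1}$; if $n$ is even let $c_i(\pi)$ be the number of $k$ with $1\le k\le n/2$, $i<2k-1$ and $\pi_{2k}<\pi_i<\pi_{2k-1}$. The map $\Phi$: given a snake $\pi$ of type $B_n$, define $p_1,\dots,p_n$ and $w_1,\dots,w_n$ successively for $k=1,\dots,n$: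 let $i$ be the position with $\pi_i\in\{n-k+1,\overline{n-k+1}\}$. If $\pi_i=n-k+1$, set $p_k=u$ if $i$ is odd and $p_k=d$ if $i$ is even, and set $w_k=c_i(\pi)$. If $\pi_i=\overline{n-k+1}$, set $p_k=d$ if $i$ is odd and $p_k=u$ if $i$ is even, and set $w_k=h_k-c_i(\pi)$, where $h_k$ is the height of the $k$-th step in the path $p_1\cdots p_k$. Then $\Phi(\pi)=(p_1\cdots p_n;w_1\cdots w_n)$. *)

(* Defs.v *)
From HB Require Import structures.
From mathcomp Require Import all_boot all_order all_algebra.
Set Implicit Arguments. Unset Strict Implicit. Unset Printing Implicit Defensive.
Import Order.TTheory GRing.Theory Num.Theory.
Local Open Scope ring_scope.

(* A signed permutation of [n] is a word s : seq int; the entry -i is the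
   integer -i.  The usual order on int is exactly bar n < ... < bar 1 < 1 < ... < n. *)

(* 1-based access: ent s i = pi_i *)
Definition ent (s : seq int) (i : nat) : int := nth 0 s i.-1.

Definition is_signed_perm (n : nat) (s : seq int) : bool :=
  perm_eq [seq absz x | x <- s] (iota 1 n).

Definition is_snake (n : nat) (s : seq int) : bool :=
  [&& size s == n, is_signed_perm n s, 0 < ent s 1 &
      all (fun i => if odd i then ent s i.+1 < ent s i else ent s i < ent s i.+1)
          (iota 1 n.-1)].

(* Paths: true = up step u, false = down step d.
   ypos P k = y-coordinate after the first k steps. *)
Definition ypos (P : seq bool) (k : nat) : int :=
  (count id (take k P))%:Z - (count negb (take k P))%:Z.

Definition step_height (P : seq bool) (k : nat) : int :=
  Order.min (ypos P k.-1) (ypos P k).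

Definition is_ballot (n : nat) (P : seq bool) : bool :=
  (size P == n) && all (fun k => 0 <= ypos P k) (iota 0 n.+1).

Definition is_lbp (n : nat) (L : seq bool * seq int) : bool :=
  [&& is_ballot n L.1, size L.2 == n &
      all (fun k => (0 <= nth 0 L.2 k.-1) && (nth 0 L.2 k.-1 <= step_height L.1 k))
          (iota 1 n)].

Definition inv_code (n : nat) (s : seq int) (i : nat) : nat :=
  if odd n then
    count (fun k => (i < 2 * k)%N && (ent s (2 * k) < ent s i < ent s (2 * k).+1))
          (iota 1 (n.-1)./2)
  else
    count (fun k => (i < (2 * k).-1)%N && (ent s (2 * k) < ent s i < ent s (2 * k).-1))
          (iota 1 n./2).

Definition pos_of (s : seq int) (v : nat) : nat := (find (fun x => absz x == v) s).+1.

Definition phi_step (n : nat) (s : seq int) (k : nat) : bool :=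
  let i := pos_of s (n - k + 1) in
  if 0 < ent s i then odd i else ~~ odd i.

Definition phi_path (n : nat) (s : seq int) : seq bool :=
  [seq phi_step n s k | k <- iota 1 n].

Definition phi_label (n : nat) (s : seq int) (k : nat) : int :=
  let i := pos_of s (n - k + 1) in
  if 0 < ent s i then (inv_code n s i)%:Z
  else step_height (take k (phi_path n s)) k - (inv_code n s i)%:Z.

Definition Phi (n : nat) (s : seq int) : seq bool * seq int :=
  (phi_path n s, [seq phi_label n s k | k <- iota 1 n]).

(* Main.v *)
(**
   Let x be pi if n is odd and -pi if n is even, and let R be the reversed word
   of x, preceded by -(n+1) and followed by 0; then pi is a snake exactly when
   R_0 < R_1 > R_2 < ... . In R the code c_i counts the descents to the left of
   the i-th letter whose interval contains that letter.

   For 1 <= v <= n+1, replace every letter of R of absolute value at least v by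
   -(n+1) or n+1 according to its sign, and contract runs of equal letters. Read
   from v = n+1 down to 1 the contracted words realize the path: its height after
   n+1-v steps is the number of extreme letters +-(n+1) of the v-th word, minus 1.
   Conversely, the word for v+1 is obtained from the word for v by choosing an
   extreme letter X and replacing it by the letter +-v of the sign of X (up step)
   or by X, +-v, X (down step); in an up step the leading letter is not allowed.
   Up to the complement w -> h - w when n is even, the label of the step ranks X:
   the letters n+1 are numbered from the left starting at 0, followed by the
   letters -(n+1) from the right. Hence the labels allowed at a step are in
   bijection with the possible choices of X.
*)

Require Import Defs.
From HB Require Import structures.
From mathcomp Require Import all_boot all_order all_algebra.
From mathcomp Require Import zify.
Set Implicit Arguments. Unset Strict Implicit. Unset Printing Implicit Defensive.
Import Order.TTheory GRing.Theory Num.Theory.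
Local Open Scope ring_scope.

(** * Alternating words and the descents that enclose a value *)

Definition cmp (b : bool) (x y : int) : bool := if b then x < y else y < x.

Fixpoint alt (b : bool) (s : seq int) : bool :=
  if s is x :: s' then
    (if s' is y :: _ then cmp b x y else true) && alt (~~ b) s'
  else true.

Lemma alt_cons2 b x y s : alt b (x :: y :: s) = cmp b x y && alt (~~ b) (y :: s).
Proof. by []. Qed.

(** The cut letter [x] is kept in both pieces, so each adjacent pair lies in exactly one of them;
    [dsc_cat] cuts in the same way. *)
Lemma alt_cat b p x q :
  alt b (p ++ x :: q) = alt b (rcons p x) && alt (b (+) odd (size p)) (x :: q).
Proof.
elim: p b => [|a p IH] b; first by rewrite addbF.
have -> : (b (+) odd (size (a :: p))) = (~~ b (+) odd (size p)).
  by rewrite /=; case: b; case: odd.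
case: p IH => [|a' p] IH; first by rewrite addbF /= !andbT.
by rewrite !cat_cons !rcons_cons !alt_cons2 -!cat_cons -!rcons_cons IH andbA.
Qed.

Fixpoint dsc (x : int) (s : seq int) : nat :=
  if s is a :: s' then
    ((if s' is b :: _ then (b < x < a)%R else false) + dsc x s')%N
  else 0%N.

Lemma dsc_cons2 x a b s : dsc x (a :: b :: s) = ((b < x < a)%R + dsc x (b :: s))%N.
Proof. by []. Qed.

Lemma dsc_cat x p a q : dsc x (p ++ a :: q) = (dsc x (rcons p a) + dsc x (a :: q))%N.
Proof.
elim: p => [|c p IH] //; case: p IH => [|c' p] IH; first by rewrite /= !addn0.
by rewrite !cat_cons !rcons_cons !dsc_cons2 -!cat_cons -!rcons_cons IH addnA.
Qed.

Lemma dsc_rcons x p a b : dsc x (rcons (rcons p a) b) = (dsc x (rcons p a) + (b < x < a)%R)%N.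
Proof. by rewrite -cats1 cat_rcons dsc_cat /= !addn0. Qed.

Lemma dsc_rcons_ge x p b : x <= b -> dsc x (rcons p b) = dsc x p.
Proof.
move=> xb; case/lastP: p => [|p a] //.
by rewrite dsc_rcons ltNge xb addn0.
Qed.

Lemma count_decomp (T : eqType) (x : T) s i : (i < count_mem x s)%N ->
  exists p q, s = p ++ x :: q /\ count_mem x p = i.
Proof.
elim: s i => [|y s IH] i //=; case: eqP => [->|nyx] /=.
  case: i => [|i]; first by move=> _; exists [::], s.
  by rewrite add1n ltnS => /IH [p [q [-> <-]]]; exists (x :: p), q; rewrite /= eqxx.
rewrite add0n => /IH [p [q [-> <-]]]; exists (y :: p), q; split=> //=.
by move/eqP/negPf: nyx => ->.
Qed.

Lemma count_decomp_uniq (T : eqType) (x : T) p q p' q' :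
  p ++ x :: q = p' ++ x :: q' -> count_mem x p = count_mem x p' -> p = p' /\ q = q'.
Proof.
elim: p p' => [|y p IH] [|y' p'] //=; first by case=> ->.
- by case=> <- _; rewrite eqxx.
- by case=> -> _; rewrite eqxx.
by case=> -> e /addnI c; have [-> ->] := IH _ e c.
Qed.

(** * Codes of single letters *)

Definition letter (R : seq int) (v : nat) : int := if v%:Z \in R then v%:Z else - v%:Z.

(* The sign of the letter of absolute value v, the parity of its position, and its
   inversion code. *)
Definition code (R : seq int) (v : nat) : bool * bool * nat :=
  let x := letter R v in (0 < x, odd (index x R), dsc x (take (index x R) R)).

(** As [x] is the only letter of absolute value [v], its code can be read off the splitting at
    [x]. *)
Lemma code_cat p x q v : (0 < v)%N -> absz x = v ->
  count (fun z => absz z == v) (p ++ x :: q) = 1%N ->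
  code (p ++ x :: q) v = (0 < x, odd (size p), dsc x p).
Proof.
move=> v0 xv; rewrite count_cat /= xv eqxx => c.
have np : forall z, z \in p -> absz z != v.
  move=> z zp; apply/negP=> zv.
  have : has (fun z => absz z == v) p by apply/hasP; exists z.
  by rewrite has_count; lia.
have nq : forall z, z \in q -> absz z != v.
  move=> z zp; apply/negP=> zv.
  have : has (fun z => absz z == v) q by apply/hasP; exists z.
  by rewrite has_count; lia.
have lx : letter (p ++ x :: q) v = x.
  rewrite /letter mem_cat inE; case: (v%:Z =P x) => [->|/eqP vx].
    by rewrite orbT.
  have /negPf -> : v%:Z \notin p by apply/negP => /np; rewrite eqxx.
  have /negPf -> : v%:Z \notin q by apply/negP => /nq; rewrite eqxx.
  by rewrite /=; lia.
have xp : x \notin p by apply/negP => /np; rewrite xv eqxx.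
have ix : index x (p ++ x :: q) = size p.
  by rewrite index_cat (negPf xp) /= eqxx addn0.
by rewrite /code lx ix take_size_cat.
Qed.

Lemma dsc_subst x p X Y q : (x < X) = (x < Y) -> (X < x) = (Y < x) ->
  dsc x (p ++ X :: q) = dsc x (p ++ Y :: q).
Proof.
move=> e1 e2; rewrite dsc_cat [RHS]dsc_cat; congr (_ + _)%N.
  by case/lastP: p => [|p a] //; rewrite !dsc_rcons e2.
by case: q => [|b q] //; rewrite !dsc_cons2 e1.
Qed.

(* With the type given explicitly all counts are syntactically equal, not merely
   convertible through different structures of int. *)
Local Notation occ x := (count (@pred1 int x)).

(** * Words of a stage: insertion and contraction of one letter *)

Section Stages.

Variable M : nat.
Hypothesis M_gt0 : (0 < M)%N.
Implicit Types (p q R : seq int) (X x z : int) (v u : nat) (b up : bool).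

Definition extreme z := absz z == M.

(* The words of the v-th stage: the letters of absolute value below v are those of
   the final word, the larger ones are still represented by M and -M. *)
Record stage v R : Prop := Stage {
  stage_alt : alt true R;
  stage_head : head 0 R = - M%:Z;
  stage_last : last 1 R = 0;
  stage_bound : all (fun z => absz z <= M)%N R;
  stage_count : forall u, (u < M)%N -> count (fun z => absz z == u) R = (u < v)%N }.

Definition fill X v : int := if 0 < X then v%:Z else - v%:Z.

Definition block up X v := if up then [:: fill X v] else [:: X; fill X v; X].

Lemma stage_letter v R z : stage v R -> z \in R -> (absz z < v)%N \/ extreme z.
Proof.
move=> st zR; have := allP (stage_bound st) _ zR; rewrite /extreme leq_eqVlt.
case/orP=> [->|/(stage_count st) c]; [by right | left].
have : (0 < count (fun y => absz y == absz z) R)%N.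
  by rewrite -has_count; apply/hasP; exists z.
by rewrite c lt0b.
Qed.

Lemma stage_tail v p X q : stage v (p ++ X :: q) -> extreme X -> exists y q', q = y :: q'.
Proof.
move=> st /eqP HX; case: q st => [|y q] st; last by exists y, q.
have := stage_last st; rewrite last_cat /= => X0; move: HX; rewrite X0 => /=; lia.
Qed.

Lemma extremeP X : extreme X -> X = M%:Z /\ (0 < X) = true \/ X = - M%:Z /\ (0 < X) = false.
Proof. rewrite /extreme; lia. Qed.

(** [M] cannot be below its right neighbour, nor [-M] above it, so [M] stands only at peaks (odd
    indices, counted from 0) and [-M] only at valleys. *)
Lemma stage_parity v p X q : (v <= M)%N -> stage v (p ++ X :: q) -> extreme X ->
  odd (size p) = (0 < X).
Proof.
move=> vM st HX; have [y [q' eq]] := stage_tail st HX.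
have := stage_alt st; rewrite eq alt_cat => /andP [_]; rewrite alt_cons2 => /andP [c _].
have yR : y \in p ++ X :: q by rewrite eq !(mem_cat, inE) eqxx !orbT.
have := allP (stage_bound st) _ yR => yM.
by case: (extremeP HX) c => [] [eX ->]; rewrite /cmp eX; case: odd => /=; lia.
Qed.

Lemma fill_abs X v : absz (fill X v) = v.
Proof. rewrite /fill; case: ifP; lia. Qed.

(** The neighbours of [X] are smaller than [v] in absolute value or extreme of the other sign, so
    [fill X v] compares with them as [X] does. In an up step [p] is nonempty because the head must
    remain [-M]. *)
Lemma stage_step v p X q up : (0 < v < M)%N -> stage v (p ++ X :: q) -> extreme X ->
  (up -> p != [::]) -> stage v.+1 (p ++ block up X v ++ q).
Proof.
move=> /andP [v0 vM] st HX Hp.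
have [y [q' eq]] := stage_tail st HX.
have par := stage_parity (ltnW vM) st HX.
have letters := fun z => @stage_letter v _ z st.
split.
- have := stage_alt st; rewrite alt_cat par => /andP [a1 a2].
  rewrite /block; case: up Hp => Hp; last first.
    rewrite /= alt_cat a1 par eq /= negbK; move: a2; rewrite eq /= => /andP[-> ->].
    rewrite !andbT /cmp /fill.
    by case: (extremeP HX) => [] [eX ->] /=; lia.
  move: {Hp} (Hp isT); case/lastP: p st par letters a1 => [//|p a] st par letters a1 _.
  rewrite cat_rcons eq /= alt_cat.
  move: a1; rewrite -cats1 cat_rcons alt_cat => /andP[-> /=]; rewrite !andbT => c1.
  move: par; rewrite size_rcons /= => par.
  move: a2 c1; rewrite eq alt_cons2 => /andP[c2 a3].
  have -> : odd (size p) = ~~ (0 < X) by rewrite -par negbK.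
  rewrite /= in a3; rewrite /= negbK a3 andbT.
  have := letters a; have := letters y; rewrite eq cat_rcons !(mem_cat, inE) !eqxx !orbT.
  move=> /(_ isT) ly /(_ isT) la.
  by rewrite /fill /cmp; case: (extremeP HX) c2 => [] [eX ->] /=;
    move: ly la; rewrite /extreme; lia.
- move: (stage_head st); case: p Hp {st par letters} => [|a p] Hp //=.
  by case: up Hp => // /(_ isT).
- move: (stage_last st); rewrite !last_cat eq /=; case: up Hp => //=.
- have := stage_bound st; rewrite !all_cat /= => /and3P[-> H ->]; rewrite andbT /=.
  by rewrite /block; case: up Hp => _ /=; rewrite fill_abs ?H; lia.
move=> u uM; have := stage_count st uM; rewrite !count_cat /=.
have -> : (absz X == u) = false by move: HX; rewrite /extreme; lia.
have -> : count (fun z => absz z == u) (block up X v) = (v == u).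
  rewrite /block; case: up {Hp} => /=; rewrite fill_abs ?addn0 //.
  have -> : (absz X == u) = false by move: HX; rewrite /extreme; lia.
  by rewrite addn0.
by case: (ltngtP u v) => /=; lia.
Qed.

(** Let [x] be the letter of absolute value [v]. A positive peak or a negative valley can be pushed
    out to the extreme value (up). Otherwise both neighbours lie beyond [x] on the same side of 0,
    so both are extreme and equal to [X], and the three letters contract to one (down). *)
Lemma stage_contract v R : (0 < v < M)%N -> stage v.+1 R ->
  exists p X q up, [/\ extreme X, R = p ++ block up X v ++ q, stage v (p ++ X :: q)
    & up -> p != [::]].
Proof.
move=> /andP [v0 vM] st.
have /hasP [x xR /eqP xv] : has (fun z => absz z == v) R.
  by rewrite has_count (stage_count st) ?ltnS ?leqnn.
have letters := fun z => @stage_letter _ _ z st.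
case/splitPr: xR st letters => p' q' st letters.
case/lastP: p' st letters => [|p a] st letters.
  have := stage_head st => /= xM; move: xv; rewrite xM; lia.
case: q' st letters => [|b q] st letters.
  have := stage_last st; rewrite last_cat /= => x0; move: xv; rewrite x0 /=; lia.
have la : (absz a < v.+1)%N \/ extreme a.
  by apply: letters; rewrite !(mem_cat, mem_rcons, inE) eqxx.
have lb : (absz b < v.+1)%N \/ extreme b.
  by apply: letters; rewrite !(mem_cat, inE) eqxx !orbT.
pose X : int := if 0 < x then M%:Z else - M%:Z.
have HX : extreme X by rewrite /X /extreme; case: ifP; lia.
have X_gt0 : (0 < X) = (0 < x) by rewrite /X; case: ifP; lia.
have fX : fill X v = x by rewrite /fill X_gt0; case: ifP; lia.
have HXx : forall u, (u < M)%N -> (absz X == u) = false.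
  by move=> u uM; move: HX; rewrite /extreme; lia.
have := stage_alt st; rewrite cat_rcons alt_cat !alt_cons2 => /and4P [a1 c1 c2 a2].
have avb : forall u, (u < M)%N ->
    (count (fun z => absz z == u) p + ((absz a == u) + ((absz x == u) + ((absz b == u)
      + count (fun z => absz z == u) q))))%N = (u < v.+1)%N.
  by move=> u /(stage_count st); rewrite cat_rcons count_cat.
have axb := avb v vM; rewrite xv eqxx ltnS leqnn in axb.
have av : absz a != v by move: axb; case: eqP => //=; lia.
have bv : absz b != v by move: axb; case: (absz b =P v) => //=; lia.
(* The index of [x] is [size p + 1], so the left side says that [x] is a peak. *)
have [up_|down_] := boolP ((true (+) odd (size p)) == (0 < x)).
  exists (rcons p a), X, (b :: q), true; split=> //.
  - by rewrite /= fX cat_rcons.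
  - split.
    + rewrite cat_rcons alt_cat !alt_cons2 a1 a2 andbT.
      move: c1 c2 av bv la lb; rewrite /X /cmp (eqP up_) /extreme.
      by case x0: (0 < x) => /=; lia.
    + by have := stage_head st; case: (p).
    + by have := stage_last st; rewrite !last_cat.
    + have := stage_bound st; rewrite !all_cat /= => /and3P[-> _ ->].
      by move: HX; rewrite /extreme andbT; lia.
    + move=> u uM; have := avb u uM; rewrite cat_rcons count_cat /= HXx //.
      by rewrite xv; clear; case: (ltngtP u v) => //=; lia.
  - by move=> _; rewrite -size_eq0 size_rcons.
have aX : a = X.
  move: c1 c2 av bv la lb down_; rewrite /X /cmp /extreme.
  by case: addb; case x0: (0 < x) => /=; lia.
have bX : b = X.
  move: c1 c2 av bv la lb down_; rewrite /X /cmp /extreme.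
  by case: addb; case x0: (0 < x) => /=; lia.
rewrite -> aX, bX in *.
exists p, X, q, false; split=> //.
- by rewrite /= fX.
- split.
  + by rewrite alt_cat a1; move: a2; rewrite negbK.
  + by have := stage_head st; case: (p).
  + by have := stage_last st; rewrite !last_cat.
  + have := stage_bound st; rewrite cat_rcons !all_cat /= => /and3P[-> _].
    by case/and3P => _ -> ->.
  + move=> u uM; have := avb u uM; rewrite count_cat /= HXx //.
    by rewrite xv; clear; case: (ltngtP u v) => //=; lia.
Qed.

(** [X] and [fill X v] lie on the same side of [x], so no descent inside the block encloses [x], and
    the ends of the block act like [X]. *)
Lemma dsc_block x p X q v up : extreme X -> (absz x < v < M)%N ->
  dsc x (p ++ block up X v ++ q) = dsc x (p ++ X :: q).
Proof.
move=> HX xv; rewrite /block; case: up => /=.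
  by apply: dsc_subst; rewrite /fill; case: (extremeP HX) => [] [eX ->] /=; lia.
rewrite dsc_cat [RHS]dsc_cat !dsc_cons2; congr (_ + _)%N.
have -> : (fill X v < x < X) = false.
  by rewrite /fill; case: (extremeP HX) => [] [eX ->] /=; lia.
suff -> : (X < x < fill X v) = false by [].
by rewrite /fill; case: (extremeP HX) => [] [eX ->] /=; lia.
Qed.

(** A block has one or three letters, so indices to its right keep their parity. Hence the code of a
    letter no longer changes once it is inserted. *)
Lemma code_step v p X q up u : (0 < v < M)%N -> stage v (p ++ X :: q) -> extreme X ->
  (up -> p != [::]) -> (0 < u < v)%N ->
  code (p ++ block up X v ++ q) u = code (p ++ X :: q) u.
Proof.
move=> vM st HX Hp /andP[u0 uv].
have uM : (u < M)%N by lia.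
have := stage_count st uM; rewrite uv => c.
have := stage_count (stage_step vM st HX Hp) uM; rewrite ltnS ltnW // => c'.
have /hasP [x xR /eqP xu] : has (fun z => absz z == u) (p ++ X :: q).
  by rewrite has_count c.
move: xR; rewrite mem_cat inE => /or3P[xp|/eqP xX|xq].
- case/splitPr: xp c c' => p1 p2; rewrite -!catA !cat_cons => c c'.
  by rewrite !code_cat.
- by move: HX; rewrite /extreme -xX xu; lia.
case/splitPr: xq c c' => q1 q2.
have -> : p ++ block up X v ++ q1 ++ x :: q2 = (p ++ block up X v ++ q1) ++ x :: q2.
  by rewrite -!catA.
have -> : p ++ X :: q1 ++ x :: q2 = (p ++ X :: q1) ++ x :: q2 by rewrite -!catA.
move=> c c'; rewrite !code_cat //; congr (_, _, _).
  have ob : odd (size (block up X v)) by rewrite /block; case: (up).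
  by rewrite !size_cat !oddD ob.
by apply: dsc_block => //; lia.
Qed.

(** * Counting and ranking the extreme letters *)

Definition nextreme R := count extreme R.

Lemma nextreme_split R : nextreme R = (occ M%:Z R + occ (- M%:Z) R)%N.
Proof.
rewrite /nextreme; elim: R => //= z R ->.
have -> : extreme z = ((z == M%:Z) + (z == - M%:Z) :> nat) :> nat by rewrite /extreme; lia.
by lia.
Qed.

Lemma nextreme_step v p X q up : (0 < v < M)%N -> extreme X ->
  nextreme (p ++ block up X v ++ q) + up = nextreme (p ++ X :: q) + ~~ up :> nat.
Proof.
move=> vM HX; rewrite /nextreme !count_cat /=.
have nf : extreme (fill X v) = false by rewrite /extreme fill_abs; lia.
by rewrite /block; case: up => /=; rewrite ?nf HX /=; lia.
Qed.

Lemma stage_nextreme_gt0 v R : stage v R -> (0 < nextreme R)%N.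
Proof.
(* The default [1] in [stage_last] rules out the empty word. *)
case: R => [|z R] st; first by have := stage_last st.
have /= := stage_head st; rewrite /nextreme /= => ->.
by have -> : extreme (- M%:Z) by rewrite /extreme; lia.
Qed.

Definition rank R p X : int :=
  if 0 < X then (occ M%:Z p)%:Z
  else (nextreme R).-1%:Z - (occ (- M%:Z) p)%:Z.

(** Only [M] exceeds [v], and the right neighbour of an [M] is below [v]. So the descents enclosing
    [v] are those starting at an [M]; the final [M] starts none. *)
Lemma dsc_pos v p b : (0 < v < M)%N -> (forall z, z \in p -> (absz z < v)%N \/ extreme z) ->
  alt b (rcons p M%:Z) -> dsc v%:Z (rcons p M%:Z) = occ M%:Z p.
Proof.
move=> vM; elim: p b => [|a p IH] b Hp //.
have Ha := Hp a (mem_head _ _).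
have {}IH := IH (~~ b) (fun z zp => Hp z (mem_behead (s := a :: p) zp)).
case: p Hp IH => [|c p] Hp IH.
  rewrite /= andbT => cm; suff -> : (M%:Z < v%:Z < a) = (a == M%:Z) by [].
  by move: cm Ha; rewrite /cmp /extreme; case: b {IH}; lia.
have Hc : (absz c < v)%N \/ extreme c by apply: Hp; rewrite !inE eqxx orbT.
rewrite !rcons_cons alt_cons2 dsc_cons2 -!rcons_cons => /andP[cm /IH ->] /=.
suff -> : (c < v%:Z < a) = (a == M%:Z) by [].
by move: cm Ha Hc; rewrite /cmp /extreme; case: b {IH}; lia.
Qed.

(** Dually, the descents enclosing [-v] are those ending at a [-M]; the first letter [a] ends
    none. *)
Lemma dsc_neg v p a b : (0 < v < M)%N ->
  (forall z, z \in a :: p -> (absz z < v)%N \/ extreme z) ->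
  alt b (a :: p) -> dsc (- v%:Z) (a :: p) = occ (- M%:Z) p.
Proof.
move=> vM; elim: p a b => [|c p IH] a b Hp //.
have Ha := Hp a (mem_head _ _).
have Hc : (absz c < v)%N \/ extreme c by apply: Hp; rewrite !inE eqxx orbT.
rewrite alt_cons2 dsc_cons2 => /andP[cm al].
rewrite (IH _ (~~ b)) // => [|z zp]; last by apply: Hp; rewrite inE zp orbT.
suff -> : (c < - v%:Z < a) = (c == - M%:Z) by [].
by move: cm Ha Hc; rewrite /cmp /extreme; case: b {al}; lia.
Qed.

(** The new letter replaces [X] in an up step and stands behind [X] in a down step. A negative [X]
    other than the head ends a descent enclosing the new letter, which is missing in an up step,
    whence [c + up]; a positive [X] ends no descent. *)
Lemma code_new v p X q up : (0 < v < M)%N -> stage v (p ++ X :: q) -> extreme X ->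
  (up -> p != [::]) ->
  exists2 c, code (p ++ block up X v ++ q) v = (0 < X, odd (size p) (+) ~~ up, c) &
    if 0 < X then c = occ M%:Z p else (c + up)%N = occ (- M%:Z) p.
Proof.
move=> vM st HX Hp; have v0 : (0 < v)%N by lia.
have := stage_count (stage_step vM st HX Hp) (_ : v < M)%N.
rewrite ltnS leqnn => /(_ ltac:(lia)) c1.
have letters : forall z, z \in p ++ [:: X] -> (absz z < v)%N \/ extreme z.
  move=> z zp; apply: (stage_letter st); move: zp.
  by rewrite !mem_cat !inE => /orP[->|->] //; rewrite orbT.
have := stage_alt st; rewrite alt_cat => /andP[al _].
exists (dsc (fill X v) (if up then p else rcons p X)).
  move: c1; rewrite /block; case: up {Hp} => /= c1.
    rewrite code_cat ?fill_abs //; congr (_, _, _); last by rewrite addbF.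
    by rewrite /fill; case: ifP; lia.
  rewrite -cat_rcons in c1 *.
  rewrite code_cat ?fill_abs //; congr (_, _, _); last by rewrite size_rcons addbT.
  by rewrite /fill; case: ifP; lia.
rewrite /fill; case: (extremeP HX) => [] [eX ->].
  have <- : dsc v%:Z (rcons p M%:Z) = occ M%:Z p.
    apply: (@dsc_pos _ _ true) => //; last by rewrite -eX.
    by move=> z zp; apply: letters; rewrite mem_cat zp.
  rewrite eX; case: (up) => //; rewrite dsc_rcons_ge //; lia.
(* For nonempty [p], the head is counted in [p] but ends no descent, while [X] is outside [p] and
   ends one; the two cancel. *)
have dn : dsc (- v%:Z) (rcons p X) = occ (- M%:Z) p.
  have := stage_head st.
  case: p letters al {st Hp c1} => [|a p] letters al //= aM.
  have lt : forall z, z \in a :: rcons p X -> (absz z < v)%N \/ extreme z.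
    by move=> z zp; apply: letters; rewrite cats1.
  have := dsc_neg vM lt al => /= ->.
  by rewrite -cats1 count_cat aM /= eX eqxx addn0 addnC.
case: up Hp {c1} => Hp; last by rewrite addn0.
rewrite -dn.
move: (Hp isT); case/lastP: p al letters {st Hp dn} => [//|p a] al letters _.
rewrite dsc_rcons; congr (_ + _)%N.
have La := letters a; rewrite mem_cat mem_rcons inE eqxx in La.
move: al La; rewrite -!cats1 -catA alt_cat /= => /and3P[_ cm _] /(_ isT).
by move: cm; rewrite /cmp /extreme; case: odd => /=; lia.
Qed.

(** The number from which [c] is subtracted, [(nextreme (p ++ X :: q)).-1 - up], will be the height
    of the step. *)
Lemma code_new_step v p X q up : (0 < v < M)%N -> stage v (p ++ X :: q) -> extreme X ->
  (up -> p != [::]) ->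
  exists c, [/\ code (p ++ block up X v ++ q) v = (0 < X, (0 < X) (+) ~~ up, c) &
    (if 0 < X then c%:Z else (nextreme (p ++ X :: q)).-1%:Z - up%:Z - c%:Z)
       = rank (p ++ X :: q) p X].
Proof.
move=> vM st HX Hp; have [c cE cr] := code_new vM st HX Hp.
rewrite (stage_parity _ st HX) in cE; last by lia.
exists c; split=> //; rewrite /rank; case: ifP cr => _; first by move->.
by move=> <-; lia.
Qed.

Lemma rank_range p X q : extreme X ->
  0 <= rank (p ++ X :: q) p X <= (nextreme (p ++ X :: q)).-1%:Z.
Proof.
move=> HX; rewrite /rank nextreme_split !count_cat /=.
case: (extremeP HX) => [] [eX ->]; rewrite eX ?eqxx; first by lia.
lia.
Qed.

(** The leading [-M] alone has the largest rank; forbidding it in an up step lowers the bound by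
    one, just as the height of an up step is one below its upper end. *)
Lemma rank_lt v p X q : stage v (p ++ X :: q) -> extreme X -> p != [::] ->
  rank (p ++ X :: q) p X < (nextreme (p ++ X :: q)).-1%:Z.
Proof.
case: p => [//|a p] st HX _; have /= aM := stage_head st.
rewrite aM /rank !nextreme_split /= !count_cat /= eqxx.
have -> : extreme (- M%:Z) by rewrite /extreme; lia.
by case: (extremeP HX) => [] [eX ->]; rewrite eX ?eqxx; lia.
Qed.

Lemma rank_nil v X q : stage v (X :: q) ->
  rank (X :: q) [::] X = (nextreme (X :: q)).-1%:Z.
Proof.
move=> st; have /= -> := stage_head st; rewrite /rank.
have -> : (0 < - M%:Z) = false by lia.
by rewrite /= subr0.
Qed.

Lemma rank_surj R (w : int) : 0 <= w <= (nextreme R).-1%:Z -> (0 < nextreme R)%N ->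
  exists p X q, [/\ R = p ++ X :: q, extreme X & rank R p X = w].
Proof.
move=> Hw N0; have := nextreme_split R => NE.
have [wa|wa] := boolP (w < (occ M%:Z R)%:Z).
  have [|p [q [RE pE]]] := @count_decomp int M%:Z R (absz w); first by lia.
  exists p, M%:Z, q; split=> //; first by rewrite /extreme; lia.
  rewrite /rank; have -> : 0 < M%:Z by lia.
  by lia.
have [|p [q [RE pE]]] := @count_decomp int (- M%:Z) R (absz ((nextreme R).-1%:Z - w)).
  by lia.
exists p, (- M%:Z), q; split=> //; first by rewrite /extreme; lia.
rewrite /rank; have -> : (0 < - M%:Z) = false by lia.
by lia.
Qed.

(** Ranks of letters [M] are below [occ M R] and those of [-M] are not, so equal ranks give equal
    signs and then equally many earlier occurrences. *)
Lemma rank_inj R p X q p' X' q' : R = p ++ X :: q -> R = p' ++ X' :: q' ->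
  extreme X -> extreme X' -> rank R p X = rank R p' X' -> [/\ p = p', X = X' & q = q'].
Proof.
move=> RE RE' HX HX'.
have aux : forall p1 x q1, R = p1 ++ x :: q1 -> (occ x p1 < occ x R)%N.
  by move=> p1 x q1 ->; rewrite count_cat /= eqxx; lia.
have := aux _ _ _ RE; have := aux _ _ _ RE'; have := nextreme_split R.
rewrite /rank.
case: (extremeP HX) => [] [eX ->]; case: (extremeP HX') => [] [eX' ->]; rewrite eX eX';
  move: RE RE'; rewrite eX eX' => RE RE' NE l1 l2 rk;
  try by exfalso; lia.
- by case: rk => cE; have [-> ->] := @count_decomp_uniq int _ _ _ _ _ (etrans (esym RE) RE') cE.
have cE : occ (- M%:Z) p = occ (- M%:Z) p' by lia.
by have [-> ->] := @count_decomp_uniq int _ _ _ _ _ (etrans (esym RE) RE') cE.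
Qed.

(** * The words of the first stage *)

Fixpoint skeleton b m : seq int :=
  if m is m'.+1 then (if b then - M%:Z else M%:Z) :: skeleton (~~ b) m' else [:: 0].

Lemma skeleton_alt b m : alt b (skeleton b m).
Proof.
elim: m b => [|m IH] b //; have := IH (~~ b).
by case: m {IH} => [|m] /= h; rewrite ?h /cmp ?andbT; case: b {h} => /=; lia.
Qed.

Lemma extremeM b : extreme (if b then - M%:Z else M%:Z).
Proof. by rewrite /extreme; case: b; lia. Qed.

Lemma nextreme_skeleton b m : nextreme (skeleton b m) = m.
Proof.
elim: m b => [|m IH] b; last by rewrite /= /nextreme /= extremeM -/(nextreme _) IH.
by rewrite /nextreme /= /extreme; lia.
Qed.

Lemma stage_skeleton m : stage 1 (skeleton true m.+1).
Proof.
split=> //; first exact: skeleton_alt.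
- by rewrite /=; elim: m false (- M%:Z) => [|m IH] b x /=.
- by elim: (m.+1) true => [|k IH] b //=; rewrite IH andbT; case: b; lia.
move=> u uM; elim: (m.+1) true => [|k IH] b /=; first by rewrite addn0 ltnS leqn0 eq_sym.
by rewrite IH (eqP (extremeM b)) (gtn_eqF uM).
Qed.

(** The only zero is the last letter, and alternation forces the signs before it, so only the number
    of extreme letters is free. *)
Lemma skeletonE b s : alt b s -> last 1 s = 0 -> all (fun z => extreme z || (z == 0)) s ->
  count (fun z => absz z == 0%N) s = 1%N -> s = skeleton b (nextreme s).
Proof.
elim: s b => [|x s IH] b // al ls /andP[xnt ss].
have [x0|nx0] := eqVneq x 0.
  case: s {IH} al ls ss => [|y s] al ls ss.
    by rewrite x0 /nextreme /= /extreme; have -> : (absz 0 == M) = false by lia.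
  have : has (fun z => absz z == 0%N) (y :: s).
    by apply/hasP; exists 0; rewrite // -ls /= mem_last.
  by rewrite has_count x0 /= => cp c; exfalso; lia.
have {}xnt : extreme x by move: xnt; rewrite (negPf nx0) orbF.
case: s IH al ls ss => [|y s] IH al ls ss c; first by rewrite [last _ _]/= in ls; lia.
move: al; rewrite alt_cons2 => /andP[cm al].
rewrite /nextreme [count _ (x :: _)]/= xnt /= -/(nextreme (y :: s)) -(IH (~~ b)) //; last first.
  by move: c; rewrite [count _ (x :: _)]/=; case: (absz x =P 0%N) => // ?; lia.
congr (_ :: _); move: ss => /= /andP[+ _].
by move: xnt cm; rewrite /extreme /cmp; case: b {IH al}; lia.
Qed.

Lemma stage1E R : stage 1 R -> R = skeleton true (nextreme R).
Proof.
move=> st; apply: skeletonE; [exact: stage_alt st | exact: stage_last st | |].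
  apply/allP => z zR; have [|->] // := stage_letter st zR.
  by rewrite ltnS leqn0 absz_eq0 orbC => ->.
by rewrite (stage_count st M_gt0).
Qed.

(** * Words realizing a given path with labels *)

Section Chain.

Variables (step : nat -> bool) (w y : nat -> int).
Hypothesis yS : forall v, (0 < v < M)%N -> y v.+1 = y v + (if step v then -1 else 1).

(** By [yS] this is the smaller of [y v] and [y v.+1]: growing [v] reads the path backwards, and an
    up step ends at [y v]. *)
Definition ht v : int := y v - (step v)%:Z.

Definition fits R v :=
  let: (s, o, c) := code R v in
  step v = (s == o) /\ w v = if s then c%:Z else ht v - c%:Z.

(** [fits] forces the kind of contraction to be [step v] and the rank of the chosen letter to be
    [w v]; the codes of smaller letters survive, so the argument can be repeated. *)
Lemma fits_contract v R : (0 < v < M)%N -> stage v.+1 R -> (nextreme R)%:Z = y v.+1 + 1 ->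
  fits R v ->
  exists p X q, [/\ [/\ R = p ++ block (step v) X v ++ q, extreme X & step v -> p != [::]],
    stage v (p ++ X :: q), (nextreme (p ++ X :: q))%:Z = y v + 1, w v = rank (p ++ X :: q) p X
    & forall u, (0 < u < v)%N -> code R u = code (p ++ X :: q) u].
Proof.
move=> vM st NR; have [p [X [q [up [HX RE st' Hp]]]]] := stage_contract vM st.
have [c [cE rE]] := code_new_step vM st' HX Hp.
rewrite /fits RE cE => -[sv wv].
have {sv} upE : up = step v by rewrite sv; case: (0 < X); case: (up).
have Ns := nextreme_step p q up vM HX; rewrite -RE in Ns.
rewrite -> upE in *.
have NE : (nextreme (p ++ X :: q))%:Z = y v + 1.
  by have := yS vM; case: step Ns => /=; lia.
exists p, X, q; split=> //; last by move=> u uv; rewrite (code_step vM st' HX Hp uv).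
rewrite -rE wv /ht; case: (0 < X) => //.
by have := stage_nextreme_gt0 st'; lia.
Qed.

(** Every stage has an extreme letter, whence [0 <= y v]; the labels are ranks, bounded by
    [rank_range] and, in an up step, by [rank_lt]. *)
Lemma fits_bounds V R : (0 < V <= M)%N -> stage V R -> (nextreme R)%:Z = y V + 1 ->
  (forall u, (0 < u < V)%N -> fits R u) ->
  0 <= y V /\ forall v, (0 < v < V)%N -> 0 <= y v /\ 0 <= w v <= ht v.
Proof.
elim: V R => [//|v IH] R vM st NR FR.
split; first by have := stage_nextreme_gt0 st; lia.
case: (posnP v) => [->|v0]; first by case=> [|[]].
have vM' : (0 < v < M)%N by lia.
have [|p [X [q [[RE HX Hp] st' NE wE cE]]]] := fits_contract vM' st NR.
  by apply: FR; lia.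
have [||y0 IHu] := IH _ _ st' NE; first by lia.
  by move=> u uv; rewrite /fits -cE //; apply: FR; lia.
move=> u uv; have [->|nuv] := eqVneq u v; last by apply: IHu; lia.
split=> //; rewrite wE /ht.
have := rank_range p q HX; have := stage_nextreme_gt0 st'.
by case: step Hp => [/(_ isT) /(rank_lt st' HX)|_]; lia.
Qed.

(** The contracted words agree by induction, and by [rank_inj] the same letter was expanded in
    both. *)
Lemma fits_inj V R R' : (0 < V <= M)%N -> stage V R -> stage V R' ->
  (nextreme R)%:Z = y V + 1 -> (nextreme R')%:Z = y V + 1 ->
  (forall u, (0 < u < V)%N -> fits R u) -> (forall u, (0 < u < V)%N -> fits R' u) ->
  R = R'.
Proof.
elim: V R R' => [//|v IH] R R' vM st st' NR NR' FR FR'.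
case: (posnP v) => [v0|v0].
  rewrite v0 in st st'; rewrite (stage1E st) (stage1E st').
  by have -> : nextreme R = nextreme R' by lia.
have vM' : (0 < v < M)%N by lia.
have [|p [X [q [[RE HX Hp] s1 NE wE cE]]]] := fits_contract vM' st NR.
  by apply: FR; lia.
have [|p' [X' [q' [[RE' HX' Hp'] s1' NE' wE' cE']]]] := fits_contract vM' st' NR'.
  by apply: FR'; lia.
have pq : p ++ X :: q = p' ++ X' :: q'.
  apply: IH => //; first by lia.
    by move=> u uv; rewrite /fits -cE //; apply: FR; lia.
  by move=> u uv; rewrite /fits -cE' //; apply: FR'; lia.
have [] := @rank_inj (p ++ X :: q) p X q p' X' q' (erefl _) pq HX HX'.
  by rewrite -wE [in RHS]pq.
by rewrite RE RE' => -> -> ->.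
Qed.

(** Start from the skeleton with [y 1 + 1] extreme letters and expand at each stage the letter of
    rank [w v]. *)
Lemma fits_exists V : (0 < V <= M)%N -> (forall v, (0 < v <= M)%N -> 0 <= y v) ->
  (forall v, (0 < v < M)%N -> 0 <= w v <= ht v) ->
  exists R, [/\ stage V R, (nextreme R)%:Z = y V + 1 & forall u, (0 < u < V)%N -> fits R u].
Proof.
move=> VM y0 wb; elim: V VM => [//|v IH] vM; case: (posnP v) => [->|v0].
  have y1 : 0 <= y 1%N by apply: y0; lia.
  exists (skeleton true (absz (y 1%N)).+1); split; first exact: stage_skeleton.
    by rewrite nextreme_skeleton; lia.
  by case=> [|[]].
have vM' : (0 < v < M)%N by lia.
have [|R [st NR FR]] := IH; first by lia.
have wv := wb v vM'.
have [||p [X [q [RE HX rE]]]] := @rank_surj R (w v).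
- by move: wv; rewrite /ht; lia.
- exact: stage_nextreme_gt0 st.
rewrite RE in st NR FR rE.
(* The leading letter has rank [y v], but an up step has [w v <= y v - 1]. *)
have Hp : step v -> p != [::].
  move=> sv; apply/negP => /eqP p0; rewrite p0 cat0s in st NR rE.
  have := rank_nil st; rewrite rE => wN.
  by move: wv wN NR; rewrite /ht sv; lia.
exists (p ++ block (step v) X v ++ q); split.
- exact: stage_step.
- by have := nextreme_step p q (step v) vM' HX; have := yS vM'; case: step; lia.
move=> u uv; have [->|nuv] := eqVneq u v; last first.
  have uv' : (0 < u < v)%N by lia.
  by rewrite /fits (code_step vM' st HX Hp uv'); apply: FR.
have [c [cE rE']] := code_new_step vM' st HX Hp.
rewrite /fits cE; split; first by case: (0 < X); case: step.
rewrite -rE -rE' /ht; case: (0 < X) => //.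
by have := stage_nextreme_gt0 st; lia.
Qed.

End Chain.

End Stages.

(** * Alternation and descent counts by index *)

Lemma altP b s : reflect
  (forall j, (j.+1 < size s)%N -> cmp (b (+) odd j) (nth 0 s j) (nth 0 s j.+1)) (alt b s).
Proof.
elim: s b => [|x s IH] b; first by apply: ReflectT.
case: s IH => [|y s] IH; first by apply: ReflectT.
rewrite alt_cons2; apply: (iffP andP) => [[cm /IH al] [_|j jz]|al].
- by rewrite addbF.
- by have := al j jz; rewrite /= addbN addNb.
split; first by have := al 0%N isT; rewrite addbF.
by apply/IH => j jz; have := al j.+1 jz; rewrite /= addbN addNb.
Qed.

Lemma count_iotaS (f : pred nat) m k :
  count f (iota m.+1 k) = count (fun j => f j.+1) (iota m k).
Proof. by rewrite -[m.+1]add1n iotaDl count_map. Qed.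

Lemma count_iota_add (f : pred nat) i m k :
  count f (iota (i + m) k) = count (fun j => f (i + j)%N) (iota m k).
Proof. by rewrite iotaDl count_map. Qed.

Lemma dsc_rev x t :
  dsc x (rev t) =
  count (fun m => nth 0 t m < x < nth 0 t m.+1) (iota 0 (size t).-1).
Proof.
elim: t => [|a [|b t] IH] //.
rewrite rev_cons rev_cons dsc_rcons -rev_cons IH /= count_iotaS /= addnC.
by congr (_ + _)%N; apply: eq_count.
Qed.

Lemma dsc_cons_le x a s : a <= x -> dsc x (a :: s) = dsc x s.
Proof. by move=> ax; case: s => [|b s] //; rewrite dsc_cons2 [x < a]ltNge ax andbF. Qed.

(** The pairs counted by an inversion code start at indices of one parity; [count_even] and
    [count_odd] reindex them by the [k] of [inv_code]. *)
Lemma count_even (f : pred nat) K :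
  (forall m, (m < 2 * K)%N -> odd m -> ~~ f m) ->
  count f (iota 1 (2 * K)) = count (fun k => f (2 * k)%N) (iota 1 K).
Proof.
elim: K => [|K IH] Hf //.
have -> : (2 * K.+1)%N = (2 * K + 2)%N by lia.
rewrite -[K.+1 in RHS]addn1 iotaD [iota 1 (K + 1)]iotaD !count_cat IH;
  last by move=> m mK; apply: Hf; lia.
congr (_ + _)%N; rewrite /=; have /negPf -> : ~~ f (1 + 2 * K)%N.
  by apply: Hf; lia.
by rewrite add0n; congr (f _ + _)%N; lia.
Qed.

Lemma count_odd (f : pred nat) K :
  (forall m, (m < (2 * K).+1)%N -> ~~ odd m -> ~~ f m) ->
  count f (iota 1 (2 * K).+1) = count (fun k => f (2 * k).-1%N) (iota 1 K.+1).
Proof.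
elim: K => [|K IH] Hf //.
have -> : (2 * K.+1).+1 = ((2 * K).+1 + 2)%N by lia.
rewrite -[K.+2 in RHS]addn1 iotaD [iota 1 (K.+1 + 1)]iotaD !count_cat IH;
  last by move=> m mK; apply: Hf; lia.
congr (_ + _)%N; rewrite /=; have /negPf -> : ~~ f (1 + (2 * K).+1)%N.
  by apply: Hf; lia.
by rewrite add0n; congr (f _ + _)%N; lia.
Qed.

(** * Snakes as words of the last stage *)

Definition flip (n : nat) (x : int) : int := if odd n then x else - x.

Lemma flip_inj n : injective (flip n).
Proof. by rewrite /flip => x y; case: odd => // /oppr_inj. Qed.

Lemma flipK n : involutive (flip n).
Proof. by rewrite /flip => x; case: odd => //; rewrite opprK. Qed.

Lemma flip_abs n x : absz (flip n x) = absz x.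
Proof. by rewrite /flip; case: odd; rewrite ?abszN. Qed.

Definition word (n : nat) (s : seq int) : seq int :=
  - n.+1%:Z :: rcons (rev [seq flip n x | x <- s]) 0.

Lemma word_inj n : injective (word n).
Proof.
by move=> s t [] /rcons_inj [] /(can_inj revK) /(inj_map (@flip_inj n)).
Qed.

Lemma nth_word n s j : size s = n -> (0 < j <= n)%N ->
  nth 0 (word n s) j = flip n (ent s (n - j).+1).
Proof.
case: j => [//|j] sz /andP[_ jn]; rewrite /= nth_rcons size_rev size_map sz jn.
by rewrite nth_rev ?size_map ?sz ?(nth_map 0) ?sz //; lia.
Qed.

Lemma nth_word_last n s : size s = n -> nth 0 (word n s) n.+1 = 0.
Proof. by move=> sz; rewrite /= nth_rcons size_rev size_map sz ltnn eqxx. Qed.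

Lemma signed_permP n s : reflect
  (forall u, count (fun z : int => absz z == u) s = (0 < u <= n)%N) (is_signed_perm n s).
Proof.
have cE u : count (fun z : int => absz z == u) s = count_mem u [seq absz x | x <- s].
  by rewrite count_map; apply: eq_count.
have iE u : count_mem u (iota 1 n) = (0 < u <= n)%N.
  by rewrite count_uniq_mem ?iota_uniq // mem_iota; lia.
apply: (iffP idP) => [/permP pE u|H]; first by rewrite cE pE iE.
by apply/allP => u _ /=; rewrite -cE H iE.
Qed.

Lemma signed_perm_abs n s z : is_signed_perm n s -> z \in s -> (0 < absz z <= n)%N.
Proof.
move=> /perm_mem /(_ (absz z)); rewrite mem_iota => zE zs.
by move: zE; rewrite map_f //; lia.
Qed.

Lemma ent_mem n s i : size s = n -> (0 < i <= n)%N -> ent s i \in s.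
Proof. by move=> sz iN; apply: mem_nth; rewrite sz; lia. Qed.

(** The comparison with the final 0 amounts to [0 < ent s 1], the one with the leading letter always
    holds, and the one at index [j] between them is that of [s] at [n - j]; [flip] makes the
    directions agree. *)
Lemma snake_alt n s : (0 < n)%N -> size s = n -> is_signed_perm n s ->
  alt true (word n s) = (0 < ent s 1) &&
    all (fun i => if odd i then ent s i.+1 < ent s i else ent s i < ent s i.+1)
      (iota 1 n.-1).
Proof.
move=> n0 sz sp; have szw : size (word n s) = n.+2 by rewrite /= size_rcons size_rev size_map sz.
have nn : (0 < n <= n)%N by rewrite n0 leqnn.
apply/altP/andP => [al|[s1 /allP al] j].
  split.
    have := al n; rewrite szw ltnS leqnn => /(_ isT).
    rewrite nth_word_last // nth_word // subnn /flip /cmp addTb.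
    by case: odd => /=; lia.
  apply/allP => m; rewrite mem_iota => mn.
  have := al (n - m)%N; rewrite szw => /(_ ltac:(lia)).
  rewrite !nth_word //; try lia.
  have -> : (n - (n - m))%N = m by lia.
  have -> : (n - (n - m).+1).+1%N = m by lia.
  rewrite addTb oddB; last by lia.
  by rewrite /cmp /flip; case: (odd n); case: (odd m) => /=; lia.
rewrite szw => jn; case: (posnP j) => [->|j0].
  rewrite (@nth_word n s 1) // /cmp addTb.
  have /(signed_perm_abs sp) : ent s (n - 1).+1 \in s by apply: (ent_mem sz); lia.
  by rewrite -(flip_abs n) /=; lia.
have [->|jn'] := eqVneq j n.
  rewrite nth_word_last // nth_word // subnn /flip /cmp addTb.
  by case: odd => /=; lia.
have := al (n - j)%N; rewrite mem_iota => /(_ ltac:(lia)).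
rewrite !nth_word //; try lia.
have -> : (n - j.+1).+1%N = (n - j)%N by lia.
rewrite addTb oddB; last by lia.
by rewrite /cmp /flip; case: (odd n); case: (odd j) => /=; lia.
Qed.

Lemma count_flip n s u :
  count (fun z => absz z == u) (rev [seq flip n x | x <- s])
  = count (fun z : int => absz z == u) s.
Proof. by rewrite count_rev count_map; apply: eq_count => z /=; rewrite flip_abs. Qed.

Lemma snake_stage n s : (0 < n)%N -> is_snake n s ->
  stage n.+1 n.+1 (word n s) /\ nextreme n.+1 (word n s) = 1%N.
Proof.
move=> n0 /and4P[/eqP sz sp s1 sa].
have /signed_permP cs := sp; split.
  split=> //.
  - by rewrite snake_alt // s1 sa.
  - by rewrite /= last_rcons.
  - rewrite /= all_rcons /= all_rev all_map leqnn /=.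
    by apply/allP => z /(signed_perm_abs sp) /=; rewrite flip_abs; lia.
  move=> u un; rewrite /= -cats1 count_cat count_flip cs /=; lia.
rewrite /nextreme /= -cats1 count_cat count_flip cs /= /extreme; lia.
Qed.

Lemma stage_snake n R : (0 < n)%N -> stage n.+1 n.+1 R -> nextreme n.+1 R = 1%N ->
  exists2 s, is_snake n s & R = word n s.
Proof.
move=> n0 st N1.
have [R0 RE] : exists R0, R = - n.+1%:Z :: rcons R0 0.
  have := stage_head st; have := stage_last st; case: R {st N1} => [|z R] //=.
  case/lastP: R => [|R x] /=; first by move=> ->; lia.
  by rewrite last_rcons => -> ->; exists R.
pose s := [seq flip n x | x <- rev R0].
have {}RE : R = word n s.
  by rewrite /word /s -map_comp (eq_map (flipK n)) map_id revK.
rewrite RE in st N1; exists s => //.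
have cs u : count (fun z : int => absz z == u) s = (0 < u <= n)%N.
  have [un|un] := leqP u n.
    have := stage_count st (un : u < n.+1)%N.
    by rewrite ltnS un /= -cats1 count_cat count_flip /=; lia.
  (* The head is the only extreme letter, so [n.+1] does not occur in [s]; larger values are
     excluded by [stage_bound]. *)
  have [->|un'] := eqVneq u n.+1.
    by move: N1; rewrite /nextreme /= -cats1 count_cat count_flip /= /extreme; lia.
  rewrite andbF; apply/eqP; rewrite -leqn0 leqNgt -has_count; apply/hasP => -[z zs /eqP zu].
  have /(allP (stage_bound st)) : flip n z \in word n s.
    by rewrite inE mem_rcons inE mem_rev map_f ?orbT.
  by rewrite flip_abs; lia.
have sp : is_signed_perm n s by apply/signed_permP.
have sz : size s = n by have := perm_size sp; rewrite size_map size_iota.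
have := stage_alt st; rewrite snake_alt // => /andP[s1 sa].
by rewrite /is_snake sz eqxx sp s1 sa.
Qed.

Lemma pos_ofP n s v : is_signed_perm n s -> (0 < v <= n)%N ->
  [/\ (0 < pos_of s v <= size s)%N, absz (ent s (pos_of s v)) = v
    & s = take (pos_of s v).-1 s ++ ent s (pos_of s v) :: drop (pos_of s v) s].
Proof.
move=> sp vn; have hs : has (fun x : int => absz x == v) s.
  by rewrite has_count (signed_permP _ _ sp) vn.
have fs : (find (fun x : int => absz x == v) s < size s)%N by rewrite -has_find.
split=> //; first by apply/eqP; apply: (nth_find 0 hs).
by rewrite /ent /pos_of /= -drop_nth // cat_take_drop.
Qed.

(** Descents left of the letter are pairs [m], [m.+1] with [i < m] that ascend after [flip]. In a
    snake this forces [m] even for odd [n] and [m] odd for even [n], which are the pairs in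
    [inv_code]. *)
Lemma inv_codeE n s i : is_snake n s -> (0 < i <= n)%N ->
  dsc (flip n (ent s i)) (- n.+1%:Z :: rev [seq flip n x | x <- drop i s]) = inv_code n s i.
Proof.
move=> /and4P[/eqP sz sp s1 /allP sa] iN.
have xs := ent_mem sz iN.
rewrite dsc_cons_le; last first.
  by have := signed_perm_abs sp xs; rewrite -(flip_abs n); lia.
pose f m := (i < m)%N && (flip n (ent s m) < flip n (ent s i) < flip n (ent s m.+1)).
have -> : dsc (flip n (ent s i)) (rev [seq flip n x | x <- drop i s]) = count f (iota 1 n.-1).
  rewrite dsc_rev size_map size_drop sz.
  have -> : count f (iota 1 n.-1) = count f (iota (i.+1 + 0) (n - i).-1).
    have [iln|nli] := ltnP i n; last first.
      have -> : i = n by lia.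
      rewrite subnn /=; apply/eqP; rewrite -leqn0 leqNgt -has_count.
      by apply/hasP => -[m]; rewrite mem_iota /f; lia.
    have -> : n.-1 = (i + (n - i).-1)%N by lia.
    rewrite iotaD count_cat add1n addn0.
    suff -> : count f (iota 1 i) = 0%N by [].
    apply/eqP; rewrite -leqn0 leqNgt -has_count.
    by apply/hasP => -[m]; rewrite mem_iota /f; lia.
  rewrite count_iota_add; apply: eq_in_count => m; rewrite mem_iota => mn.
  rewrite /f !(nth_map 0) ?size_drop ?sz; try lia.
  rewrite !nth_drop /ent /= addSn /=.
  have -> : (i < (i + m).+1)%N by lia.
  by rewrite addnS.
have sa' m : (0 < m < n)%N ->
    if odd m then ent s m.+1 < ent s m else ent s m < ent s m.+1.
  by move=> mn; apply: sa; rewrite mem_iota; lia.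
rewrite /inv_code; case: ifP => on.
  have {1}-> : n.-1 = (2 * n.-1./2)%N by lia.
  rewrite count_even; first by apply: eq_count => k; rewrite /f /flip on.
  move=> m mn om; rewrite /f /flip on; have [m0|m0] := posnP m; first by rewrite m0 in om.
  by have := sa' m; rewrite om => /(_ ltac:(lia)); lia.
have {1}-> : n.-1 = (2 * n./2.-1).+1 by lia.
rewrite count_odd.
  have -> : n./2.-1.+1 = n./2 by lia.
  apply: eq_in_count => k; rewrite mem_iota => kn; rewrite /f /flip on.
  have -> : (2 * k).-1.+1 = (2 * k)%N by lia.
  by rewrite !ltrN2 [X in _ && X]andbC.
move=> m mn om; rewrite /f /flip on; have [m0|m0] := posnP m; first by rewrite m0 ltn0.
by have := sa' m; rewrite (negPf om) => /(_ ltac:(lia)); lia.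
Qed.

Lemma code_word n s v : (0 < n)%N -> is_snake n s -> (0 < v <= n)%N ->
  let i := pos_of s v in
  code (word n s) v = (0 < flip n (ent s i), odd (n - i).+1, inv_code n s i).
Proof.
move=> n0 sn vn i; have /and4P[/eqP sz sp _ _] := sn.
have [iN iv sE] := pos_ofP sp vn; rewrite -/i in iN iv sE; rewrite sz in iN.
have [st _] := snake_stage n0 sn.
have wE : word n s = (- n.+1%:Z :: rev [seq flip n x | x <- drop i s])
    ++ flip n (ent s i) :: rcons (rev [seq flip n x | x <- take i.-1 s]) 0.
  by rewrite /word {1}sE map_cat rev_cat /= rev_cons -!cats1 -!catA /=.
rewrite wE code_cat ?flip_abs //; last 2 first.
- by lia.
- by rewrite -wE; have := stage_count st (_ : v < n.+1)%N => ->; lia.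
by rewrite inv_codeE //= size_rev size_map size_drop sz.
Qed.

(** * The path read backwards, with labels adapted to the parity of [n] *)

Lemma yposS P k : (k < size P)%N ->
  ypos P k.+1 = ypos P k + (if nth false P k then 1 else -1).
Proof.
move=> kP; rewrite /ypos (take_nth false kP) -cats1 !count_cat /=.
by case: nth => /=; lia.
Qed.

Section Labels.

Variables (n : nat) (n_gt0 : (0 < n)%N) (P : seq bool) (W : seq int).
Hypothesis szP : size P = n.

Definition path_step v := nth false P (n - v).
Definition path_height v := ypos P (n.+1 - v).
Definition path_label v : int :=
  if odd n then nth 0 W (n - v) else step_height P (n.+1 - v) - nth 0 W (n - v).

Lemma path_heightS v : (0 < v < n.+1)%N ->
  path_height v.+1 = path_height v + (if path_step v then -1 else 1).
Proof.
move=> vn; rewrite /path_height /path_step subSS subSn; last by lia.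
by rewrite yposS ?szP; [case: nth; lia | lia].
Qed.

Lemma path_height_end : path_height n.+1 = 0.
Proof. by rewrite /path_height subnn /ypos take0. Qed.

Lemma htE v : (0 < v < n.+1)%N -> ht path_step path_height v = step_height P (n.+1 - v).
Proof.
move=> vn; have := path_heightS vn; rewrite /ht /path_height /path_step /step_height.
have -> : (n.+1 - v).-1 = (n.+1 - v.+1)%N by lia.
by move=> ->; case: nth => /=; lia.
Qed.

(** For even [n] both sign and index parity are reversed, so the step is unchanged but [c] and
    [h - c] trade places; the complement in [path_label] undoes this. *)
Lemma fits_word s v : is_snake n s -> (0 < v < n.+1)%N ->
  let k := (n.+1 - v)%N in let i := pos_of s v in
  fits path_step path_label path_height (word n s) v <->
  nth false P k.-1 = phi_step n s k /\
  nth 0 W k.-1 = if 0 < ent s i then (inv_code n s i)%:Z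
                 else step_height P k - (inv_code n s i)%:Z.
Proof.
move=> sn vn k i; have /and4P[/eqP sz sp _ _] := sn.
have vn' : (0 < v <= n)%N by lia.
have [iN iv _] := pos_ofP sp vn'; rewrite -/i in iN iv; rewrite sz in iN.
rewrite /fits code_word // htE // -/i /phi_step.
have -> : (n - k + 1)%N = v by rewrite /k; lia.
rewrite -/i /path_step /path_label -/k; have -> : (n - v)%N = k.-1 by rewrite /k; lia.
have -> : odd (n - i).+1 = ~~ (odd n (+) odd i) by rewrite /= oddB //; lia.
set h := step_height P k; set c := inv_code n s i; move: (nth false _ _) (nth 0 _ _) => b l.
have -> : (0 < flip n (ent s i)) = ((0 < ent s i) == odd n).
  by rewrite /flip; case: odd; move: iv; lia.
by case: (0 < ent s i); case: (odd n); case: (odd i) => /=; lia.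
Qed.

End Labels.

(** * Steps and labels of [Phi], and its bijectivity *)

Lemma size_phi_path n s : size (phi_path n s) = n.
Proof. by rewrite size_map size_iota. Qed.

Lemma nth_phi_path n s k : (0 < k <= n)%N -> nth false (phi_path n s) k.-1 = phi_step n s k.
Proof. by move=> kn; rewrite (nth_map 0%N) ?size_iota ?nth_iota; try lia; congr phi_step; lia. Qed.

(** The height of step [k] depends only on the first [k] steps. *)
Lemma phi_labelE n s k :
  phi_label n s k =
  let i := pos_of s (n - k + 1) in
  if 0 < ent s i then (inv_code n s i)%:Z
  else step_height (phi_path n s) k - (inv_code n s i)%:Z.
Proof.
by rewrite /phi_label /step_height /ypos !take_takel // leq_pred.
Qed.

Lemma nth_phi_labels n s k : (0 < k <= n)%N -> nth 0 (Phi n s).2 k.-1 = phi_label n s k.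
Proof. by move=> kn; rewrite (nth_map 0%N) ?size_iota ?nth_iota; try lia; congr phi_label; lia. Qed.

Lemma fits_Phi n s v : (0 < n)%N -> is_snake n s -> (0 < v < n.+1)%N ->
  fits (path_step n (Phi n s).1) (path_label n (Phi n s).1 (Phi n s).2)
    (path_height n (Phi n s).1) (word n s) v.
Proof.
move=> n0 sn vn; apply/fits_word => //; first exact: size_phi_path.
rewrite -[(Phi n s).1]/(phi_path n s) nth_phi_path ?nth_phi_labels ?phi_labelE; try lia.
by have -> : (n - (n.+1 - v) + 1)%N = v by lia.
Qed.

Theorem theorem3p1 (n : nat) (hn : (1 <= n)%N) :
  (forall s : seq int, is_snake n s -> is_lbp n (Phi n s)) /\
  (forall s t : seq int, is_snake n s -> is_snake n t -> Phi n s = Phi n t -> s = t) /\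
  (forall L : seq bool * seq int, is_lbp n L ->
     exists2 s : seq int, is_snake n s & Phi n s = L).
Proof.
have nn : (0 < n.+1 <= n.+1)%N by rewrite leqnn.
split; [move=> s sn | split=> [s t sn tn st | [P W]
  /and3P[/= /andP[/eqP szP /allP yP] /eqP szW /allP wP]]].
- have szP := size_phi_path n s.
  have [sw N1] := snake_stage hn sn.
  have [|_ bnd] := fits_bounds (ltn0Sn n) (path_heightS hn szP) nn sw _ (fun v => fits_Phi hn sn).
    by rewrite N1 path_height_end.
  rewrite /is_lbp /is_ballot -[(Phi n s).1]/(phi_path n s) szP size_map size_iota !eqxx !andTb.
  apply/andP; split.
    apply/allP => k; rewrite mem_iota => kn; case: (posnP k) => [->|k0].
      by rewrite /ypos take0.
    have [|+ _] := bnd (n.+1 - k)%N; first by lia.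
    by rewrite /path_height; have -> : (n.+1 - (n.+1 - k))%N = k by lia.
  (* For even [n] the bounds concern [h - w], and [0 <= h - w <= h] is equivalent to
     [0 <= w <= h]. *)
  apply/allP => k; rewrite mem_iota => kn.
  have kn' : (0 < n.+1 - k < n.+1)%N by lia.
  have [_] := bnd _ kn'; rewrite htE // /path_label.
  have -> : (n.+1 - (n.+1 - k))%N = k by lia.
  have -> : (n - (n.+1 - k))%N = k.-1 by lia.
  by rewrite -/(Phi n s) -[nth 0 _ _]/(nth 0 (Phi n s).2 _); case: odd => //=; lia.
- have szP := size_phi_path n s.
  have [sw Ns] := snake_stage hn sn; have [tw Nt] := snake_stage hn tn.
  have ft v : (0 < v < n.+1)%N -> _ := @fits_Phi n t v hn tn.
  (* Now the word of [t] fits the path and labels of [s]. *)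
  rewrite -st in ft.
  apply: (@word_inj n).
  apply: (fits_inj (ltn0Sn n) (path_heightS hn szP) nn sw tw _ _
    (fun v => fits_Phi hn sn) ft).
    by rewrite Ns path_height_end.
  by rewrite Nt path_height_end.
have [||R [sR NR FR]] := fits_exists (ltn0Sn n) (path_heightS hn szP) (w := path_label n P W) nn.
- by move=> v vn; apply: yP; rewrite mem_iota; lia.
- move=> v vn; rewrite htE // /path_label.
  have /= := wP (n.+1 - v)%N; rewrite mem_iota => /(_ ltac:(lia)).
  have -> : (n.+1 - v).-1 = (n - v)%N by lia.
  by case: odd; lia.
(* The path starts at height 0, so exactly one extreme letter is left. *)
have [|s sn RE] := stage_snake hn sR; first by move: NR; rewrite path_height_end; lia.
rewrite RE in FR; exists s => //.
have fw k : (0 < k <= n)%N -> nth false P k.-1 = phi_step n s k /\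
    nth 0 W k.-1 = if 0 < ent s (pos_of s (n - k + 1))
                   then (inv_code n s (pos_of s (n - k + 1)))%:Z
                   else step_height P k - (inv_code n s (pos_of s (n - k + 1)))%:Z.
  move=> kn; have kn' : (0 < n - k + 1 < n.+1)%N by lia.
  have := FR _ kn'; move/(fits_word hn W szP sn kn').
  by have -> : (n.+1 - (n - k + 1))%N = k by lia.
(* The path is recovered first, since the labels refer to its heights. *)
have PE : phi_path n s = P.
  apply: (@eq_from_nth _ false); rewrite size_phi_path ?szP // => k kn.
  by have [|-> _] := fw k.+1; [lia | rewrite -nth_phi_path].
rewrite [Phi n s]surjective_pairing; congr (_, _) => //.
apply: (@eq_from_nth _ 0); rewrite size_map size_iota ?szW // => k kn.
have [|_ wk] := fw k.+1; first by lia.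
by rewrite [RHS]wk -[nth 0 _ _]/(nth 0 (Phi n s).2 k.+1.-1) nth_phi_labels ?phi_labelE ?PE; lia.
Qed.
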